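(* Let $G$ be a one-ended finitely generated group and $H$ an infinite cyclic subgroup of $G$ with generator $h$; fix a finite generating set $S$ of $G$ containing $h$. Suppose that $div(G,H)=\{\sigma^n_\rho\}$ and $Div(G,e)=\{\delta_\rho\}$. Then, for all $\rho\in(0,1]$ and all integers $n\ge2$, $$\sigma^n_\rho\preceq \delta_\rho\circ\left(\frac{3}{\rho}\,Dist^H_G\right).$$
   Context: Domination. For functions $f,g$ with values in $[0,\infty]$ of a nonnegative (or positive) real variable, $f\preceq g$ means there are $A,B,C>0$ with $f(x)\le g(Ax)+Bx$ for all $x>C$. Notation. In the Cayley graph $X=\Gamma(G,S)$ with path metric $d$ and for a subgroup $A$ of $G$ put $N_r(A)=\{x: d(x,A)<r\}$, $\partial N_r(A)=\{x:d(x,A)=r\}$, $C_r(A)=X-N_r(A)$, and let $d_{r,A}$ be the induced length metric on $C_r(A)$ ($\infty$ for points not joined by a path in $C_r(A)$). Lower relative divergence $div(G,H)=\{\sigma^n_\rho\}$: $\sigma^n_\rho(r)=\inf d_{\rho r,H}(x_1,x_2)$ over all $x_1,x_2\in\partial N_r(H)$ with $d_{r,H}(x_1,x_2)<\infty$ and $d(x_1,x_2)\ge nr$, with $\sigma^n_\rho(r)=\infty$ if there is no such pair. Upper divergence $Div(G,e)=\{\delta_\rho\}$: $\delta_\rho(r)=\sup d_{\rho r,\{e\}}(x_1,x_2)$ over all $x_1,x_2\in\partial N_r(\{e\})$ with $d_{r,\{e\}}(x_1,x_2)<\infty$. Upper distortion: $Dist^H_G(r)=\max\{|h'|_T : h'\in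 H,\ |h'|_S\le r\}$ with $T=\{h\}$. $\frac{3}{\rho}Dist^H_G$ denotes the function $r\mapsto\frac{3}{\rho}Dist^H_G(r)$. $G$ is one-ended if it has exactly one end. *)

(* Defs.v *)
From HB Require Import structures.
From mathcomp Require Import all_boot all_order all_algebra.
From mathcomp Require Import all_classical all_reals all_analysis.

Set Implicit Arguments.
Unset Strict Implicit.
Unset Printing Implicit Defensive.

Import Order.TTheory GRing.Theory Num.Theory.
Import numFieldNormedType.Exports.

Local Open Scope classical_set_scope.
Local Open Scope ring_scope.

Section Groups.
Context {G : groupType}.
Implicit Types (S w : seq G) (g h : G).

Definition is_word S w : bool :=
  all (fun s => (s \in S) || (s^-1%g \in S)) w.

Definition represents S g (n : nat) : Prop :=
  exists w, [/\ is_word S w, size w = n & (\prod_(s <- w) s)%g = g].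

(* The default 0 is used only for g outside the subgroup generated by S. *)
Definition word_length S g : nat :=
  xget 0%N [set n | represents S g n /\
                    forall m, represents S g m -> (n <= m)%N].

Definition cyclic_subgroup h : set G :=
  [set g | exists n : nat, (g = h ^+ n)%g \/ (g = h ^- n)%g].

End Groups.

Record generating_seq (G : groupType) := GeneratingSeq {
  gens :> seq G ;
  gensP : forall g : G, exists n, represents gens g n }.

Definition cayley_adj (G : groupType) (S : seq G) : rel G :=
  fun x y => (x != y) && ((x^-1 * y \in S)%g || (y^-1 * x \in S)%g).

(* One-way infinite simple paths up to the relation of having tails in the
   same component of the complement of K, for every finite set K of
   vertices. *)
Section Ends.
Context {G : groupType} (S : generating_seq G).

Definition is_ray (r : nat -> G) : Prop :=
  injective r /\ forall k, cayley_adj S (r k) (r k.+1).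

Definition joined_outside (K : seq G) (x y : G) : Prop :=
  exists p : seq G, [/\ path (cayley_adj S) x p, last x p = y &
                        all (fun z => z \notin K) (x :: p)].

Definition ray_equiv (r1 r2 : nat -> G) : Prop :=
  forall K : seq G, exists N : nat, forall i j : nat,
    (N <= i)%N -> (N <= j)%N -> joined_outside K (r1 i) (r2 j).

Definition ends : set (set (nat -> G)) :=
  [set [set r' | is_ray r' /\ ray_equiv r r'] | r in is_ray].

Definition one_ended : Prop := exists E, ends = [set E].

End Ends.

(* Geometric realization of the simple graph with edges [cayley_adj S], every
   edge having length 1: the point at distance t from x on the edge from x
   to y is its barycentric coordinate function (1 - t) x + t y. The case
   x = y makes every vertex a point even if the graph has no edge. *)
Section CayleyGraph.
Context {R : realType} {G : groupType}.

Definition bary (x y : G) (t : R) : G -> R :=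
  fun z => (1 - t) * (z == x)%:R + t * (z == y)%:R.

Definition on_edge (x y : G) (f : G -> R) : Prop :=
  exists t : R, [/\ 0 <= t, t <= 1 & f = bary x y t].

Definition edge_or_vertex (S : seq G) (x y : G) : bool :=
  (x == y) || cayley_adj S x y.

End CayleyGraph.

Record cayley_graph (R : realType) (G : groupType) (S : generating_seq G) :=
  CayleyPoint {
    bary_coord : G -> R ;
    bary_coordP : exists x y, edge_or_vertex S x y /\ on_edge x y bary_coord }.

Section CayleyMetric.
Context (R : realType) (G : groupType) (S : generating_seq G).
Local Notation X := (cayley_graph R S).
Implicit Types (p q : X) (x y : G).

HB.instance Definition _ := gen_eqMixin X.
HB.instance Definition _ := gen_choiceMixin X.

Lemma coord_inj p q : bary_coord p = bary_coord q -> p = q.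
Proof.
case: p q => f fP [g gP] /= e; move: fP gP; rewrite e => fP gP.
by rewrite (Prop_irrelevance fP gP).
Qed.

Lemma on_edge_vertex x : on_edge x x (bary x x (0 : R)).
Proof. by exists 0; split => //; rewrite ler01. Qed.

Lemma edge_or_vertex_refl x : edge_or_vertex S x x.
Proof. by rewrite /edge_or_vertex eqxx. Qed.

Definition vertex x : X :=
  CayleyPoint (ex_intro _ x (ex_intro _ x
    (conj (edge_or_vertex_refl x) (on_edge_vertex x)))).

(* [pl_path p q l]: there is a piecewise linear path of length l from p to
   q, that is a concatenation of segments each lying in a closed edge. *)
Inductive pl_path : X -> X -> R -> Prop :=
| pl_nil p : pl_path p p 0
| pl_cons x y p q p' l :
    edge_or_vertex S x y ->
    on_edge x y (bary_coord p) -> on_edge x y (bary_coord q) ->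
    pl_path q p' l ->
    pl_path p p' (`|bary_coord p x - bary_coord q x| + l).

Definition cayley_dist p q : R := inf [set l | pl_path p q l].

Lemma pl_path_ge0 p q l : pl_path p q l -> 0 <= l.
Proof. by elim => // *; rewrite addr_ge0. Qed.

Lemma pl_path_trans p q p' l l' :
  pl_path p q l -> pl_path q p' l' -> pl_path p p' (l + l').
Proof.
move=> pq; elim: pq p' l' => [? ? ?|x y p1 q1 p2 m xy h1 h2 _ IH p' l' H].
  by rewrite add0r.
by rewrite -addrA; apply: pl_cons; eauto.
Qed.

Lemma pl_path_sym p q l : pl_path p q l -> pl_path q p l.
Proof.
elim => [?|x y p1 q1 p2 m xy h1 h2 _ IH]; first exact: pl_nil.
rewrite addrC distrC -[`|_|]addr0; apply: pl_path_trans IH _.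
exact: pl_cons xy h2 h1 (pl_nil _).
Qed.

Lemma pl_path_coord p q l z :
  pl_path p q l -> `|bary_coord p z - bary_coord q z| <= l.
Proof.
elim => [?|x y p1 q1 p2 m xy [t [t0 t1 e1]] [u [u0 u1 e2]] _ IH].
  by rewrite subrr normr0.
rewrite (le_trans (ler_distD (bary_coord q1 z) _ _))// lerD// e1 e2 /bary eqxx.
have [->|xy'] := eqVneq x y.
  by rewrite !mulr1 !subrK subrr normr0 -!mulrDl !subrK subrr normr0.
rewrite !mulr1 !mulr0 !addr0.
have [zx|zx] := eqVneq z x; have [zy|zy] := eqVneq z y.
- by move: xy'; rewrite -zx -zy eqxx.
- by rewrite !mulr1 !mulr0 !addr0.
- rewrite !mulr0 !mulr1 !add0r.
  by rewrite opprB [_ - t + _]addrC addrA subrK distrC.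
- by rewrite !mulr0 addr0 subrr normr0.
Qed.

Lemma pl_path_edge x y p q : edge_or_vertex S x y ->
  on_edge x y (bary_coord p) -> on_edge x y (bary_coord q) ->
  exists l, pl_path p q l.
Proof.
by move=> xy px qx; eexists; exact: pl_cons xy px qx (pl_nil _).
Qed.

Lemma on_edgel x y : on_edge x y (bary_coord (vertex x)).
Proof.
exists 0; split => //; apply/funext => z.
by rewrite /= /bary !mul0r.
Qed.

Lemma on_edger x y : on_edge x y (bary_coord (vertex y)).
Proof.
exists 1; split => //; apply/funext => z.
by rewrite /= /bary !mul0r subrr subr0 mul0r addr0 add0r.
Qed.

Lemma pl_path_vertex x y : exists l, pl_path (vertex x) (vertex y) l.
Proof.
have [n [w [ww _ wE]]] := gensP S (x^-1 * y)%g.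
elim: w x ww wE => [|s w IH] x.
  rewrite big_nil => _ e; exists 0.
  suff -> : x = y by exact: pl_nil.
  by rewrite -[y](mulVKg x) -e mulg1.
move=> /= /andP[sS ww]; rewrite big_cons => e.
have [l Hl] : exists l, pl_path (vertex (x * s)%g) (vertex y) l.
  by apply: IH => //; rewrite invgM -mulgA -e mulKg.
have ad : edge_or_vertex S x (x * s)%g.
  rewrite /edge_or_vertex /cayley_adj; case: eqVneq => //= _.
  by rewrite mulKg invgM -mulgA mulVg mulg1.
have [m Hm] := pl_path_edge ad (on_edgel x _) (on_edger _ _).
by exists (m + l); exact: pl_path_trans Hm Hl.
Qed.

Lemma pl_path_exists p q : exists l, pl_path p q l.
Proof.
have [x [x' [xx' px]]] := bary_coordP p.
have [y [y' [yy' qy]]] := bary_coordP q.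
have [a Ha] := pl_path_edge xx' px (on_edgel x _).
have [b Hb] := pl_path_vertex x y.
have [c Hc] := pl_path_edge yy' (on_edgel y _) qy.
by exists (a + (b + c)); apply: pl_path_trans Ha (pl_path_trans Hb Hc).
Qed.

Lemma pl_path_has_inf p q : has_inf [set l | pl_path p q l].
Proof.
split; first exact: pl_path_exists.
by exists 0 => l /= /pl_path_ge0.
Qed.

Lemma cayley_dist_le p q l : pl_path p q l -> cayley_dist p q <= l.
Proof. by move=> H; apply: ge_inf => //; case: (pl_path_has_inf p q). Qed.

Lemma cayley_dist_ge p q a :
  (forall l, pl_path p q l -> a <= l) -> a <= cayley_dist p q.
Proof. by move=> H; apply: lb_le_inf; [exact: pl_path_exists|move=> l /H]. Qed.

Lemma cayley_distxx p : cayley_dist p p = 0.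
Proof.
apply/eqP; rewrite eq_le cayley_dist_le ?cayley_dist_ge//.
- by move=> l /pl_path_ge0.
- exact: pl_nil.
Qed.

Lemma cayley_dist_positivity p q : cayley_dist p q = 0 -> p = q.
Proof.
move=> e; apply: coord_inj; apply/funext => z; apply/eqP.
rewrite -subr_eq0 -normr_le0 -e; apply: cayley_dist_ge => l.
exact: pl_path_coord.
Qed.

Lemma cayley_dist_sym p q : cayley_dist p q = cayley_dist q p.
Proof.
by congr inf; apply/seteqP; split => l /= /pl_path_sym.
Qed.

Lemma cayley_dist_triangle q p p' :
  cayley_dist p p' <= cayley_dist p q + cayley_dist q p'.
Proof.
rewrite -lerBlDr; apply: cayley_dist_ge => l Hl.
rewrite lerBlDr addrC -lerBlDr; apply: cayley_dist_ge => m Hm.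
by rewrite lerBlDr addrC; apply: cayley_dist_le; exact: pl_path_trans Hl Hm.
Qed.

HB.instance Definition _ := @isMetric.Build R X cayley_dist
  cayley_distxx cayley_dist_positivity cayley_dist_sym cayley_dist_triangle.

End CayleyMetric.

Section LengthMetric.
Context {R : realType} {X : metricType R}.

Definition curve_length (a b : R) (c : R -> X) : \bar R :=
  ereal_sup [set (\sum_(i < size s)
                    mdist (c (nth b (a :: s) i)) (c (nth b (a :: s) i.+1)))%:E
            | s in [set s | itv_partition a b s]].

Definition length_dist (Y : set X) (x1 x2 : X) : \bar R :=
  ereal_inf [set l | exists (a b : R) (c : R -> X),
    [/\ a <= b, {within `[a, b], continuous c}, c a = x1 /\ c b = x2,
        forall t, t \in `[a, b] -> Y (c t) & l = curve_length a b c]].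

Definition set_dist (x : X) (A : set X) : R := inf [set mdist x a | a in A].

End LengthMetric.

Section Divergence.
Context (R : realType) (G : groupType) (S : generating_seq G) (A : set G).
Local Notation X := (cayley_graph R S).

Definition subgroup_dist (x : X) : R := set_dist x (@vertex R G S @` A).

Definition nbhd (r : R) : set X := [set x | subgroup_dist x < r].

Definition nbhd_boundary (r : R) : set X := [set x | subgroup_dist x = r].

Definition nbhd_compl (r : R) : set X := ~` nbhd r.

Definition outer_dist (r : R) : X -> X -> \bar R := length_dist (nbhd_compl r).

(* ereal_inf set0 = +oo is the value when there is no pair (x1, x2). *)
Definition lower_divergence (n : nat) (rho r : R) : \bar R :=
  ereal_inf [set l | exists x1 x2 : X,
    [/\ nbhd_boundary r x1, nbhd_boundary r x2,
        (outer_dist r x1 x2 < +oo)%E, n%:R * r <= mdist x1 x2 &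
        l = outer_dist (rho * r) x1 x2]].

Definition upper_divergence (rho r : R) : \bar R :=
  ereal_sup [set l | exists x1 x2 : X,
    [/\ nbhd_boundary r x1, nbhd_boundary r x2,
        (outer_dist r x1 x2 < +oo)%E &
        l = outer_dist (rho * r) x1 x2]].

End Divergence.

(* For S generating and H = <h>, the supremum is over a finite set, nonempty
   if 0 <= r, hence is a maximum. *)
Definition upper_distortion (R : realType) (G : groupType) (S : seq G)
    (H : set G) (h : G) (r : R) : R :=
  sup [set (word_length [:: h] g)%:R
      | g in [set g | H g /\ (word_length S g)%:R <= r]].

Definition dominated (R : realType) (f g : R -> \bar R) : Prop :=
  exists A B C : R, [/\ 0 < A, 0 < B, 0 < C &
    forall x, C < x -> (f x <= g (A * x)%R + (B * x)%:E)%E].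

(* Main.v *)
Require Import Defs.
From mathcomp Require Import all_boot all_order all_algebra.
From mathcomp Require Import all_classical all_reals all_analysis.
From mathcomp Require Import lra.

(** Write [D] for the distortion of the cyclic subgroup at radius
[(n + 4) * x], and cut the subgroup into the half-lines of nonnegative powers
of [h] and of its inverse. Both half-lines leave the ball of radius
[3 / rho * D] around the identity for the last time at points [y] and [z] of
the sphere, and since the group has one end these are joined outside that
ball ([sphere_pair]). So the upper divergence at [3 / rho * D] is at least the
distance between [y] and [z] outside the ball of radius
[rho * (3 / rho * D) = 3 * D], and it suffices to bound the lower divergence
at [x] by the length of an arbitrary curve from [y] to [z] outside the latter
ball.

Outside the ball of radius [3 * D], points within [x] of the first half-line
are at distance at least [n * x] from points within [x] of the second one
([lines_separated]). Otherwise some [h ^+ k] and [h ^- j] near such points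
would be at distance below [(n + 4) * x], so [j + k] would be at most [D] by
the definition of the distortion, and these points would be within
[D + 2 * x <= 2 * D] of the identity.

The curve from [y] to [z] starts within [x] of the first half-line and ends
within [x] of the second. Cut it at its last exit from the [x]-neighbourhood of
the first one and at the next entry into that of the second one
([curve_crossing]). The piece in between stays outside the [x]-neighbourhood
of the whole subgroup and joins two points of its boundary that are at
distance at least [n * x]. These two points compete in the lower divergence at
[x], and their distance outside the [rho * x]-neighbourhood is at most the
length of the piece.

Two facts connect the combinatorial and the metric side: the word length of
[x^-1 * y] is a lower bound for the length of every path between the vertices
[x] and [y] ([pl_path_word_length]), and edges are rectifiable curves
([reach_edge]). *)

Set Implicit Arguments.
Unset Strict Implicit.
Unset Printing Implicit Defensive.

Import Order.TTheory GRing.Theory Num.Theory.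
Import numFieldNormedType.Exports.

Local Open Scope classical_set_scope.
Local Open Scope ring_scope.

(** * Word length and infinite cyclic subgroups *)

Section WordLength.
Context {G : groupType}.
Implicit Types (S w : seq G) (g h x y z : G).

(** The default value in [word_length] is never taken on an element that is a
word in [S]: the lengths of its expressions have a minimum. *)
Lemma word_length_represents S g n :
  represents S g n -> represents S g (word_length S g).
Proof.
move=> gn; rewrite /word_length; case: xgetP => [m _ []//|].
pose P k := `[< represents S g k >].
have exP : exists k, P k by exists n; apply/asboolP.
case: (ex_minnP exP) => m /asboolP Pm minm /(_ m) /= []; split => // k Pk.
by apply: minm; apply/asboolP.
Qed.

Lemma word_length_le S g n : represents S g n -> (word_length S g <= n)%N.
Proof.
move=> gn; rewrite /word_length; case: xgetP => [m _ [_]|//]; exact.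
Qed.

Lemma represents1 S : represents S 1%g 0.
Proof. by exists [::]; rewrite big_nil. Qed.

Lemma representsM S x y m n :
  represents S x m -> represents S y n -> represents S (x * y)%g (m + n).
Proof.
move=> [u [uS <- <-]] [v [vS <- <-]]; exists (u ++ v).
by rewrite /is_word all_cat size_cat big_cat; split => //; apply/andP.
Qed.

Lemma representsV S x m : represents S x m -> represents S x^-1%g m.
Proof.
move=> [w [wS <- <-]]; elim: w wS => [|s w IH] /=.
  by rewrite big_nil invg1 => _; exact: represents1.
move=> /andP[sS /IH wr]; rewrite big_cons invgM -addn1.
apply: representsM wr _; exists [:: s^-1%g].
by rewrite big_seq1 /= invgK orbC sS.
Qed.

Lemma represents_gen S s : s \in S -> represents S s 1.
Proof. by move=> sS; exists [:: s]; rewrite /= sS big_seq1. Qed.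

Lemma represents_expg S s n : s \in S -> represents S (s ^+ n)%g n.
Proof.
move=> sS; elim: n => [|n IH]; first by rewrite expg0; exact: represents1.
by rewrite expgS -add1n; exact: representsM (represents_gen sS) IH.
Qed.

Lemma cayley_adj_represents S x y :
  cayley_adj S x y -> represents S (x^-1 * y)%g 1.
Proof.
move=> /andP[_ /orP[/represents_gen//|/represents_gen/representsV]].
by rewrite invgM invgK.
Qed.

Lemma edge_or_vertex_mulr S x s :
  (s \in S) || (s^-1 \in S)%g -> edge_or_vertex S x (x * s)%g.
Proof.
move=> sS; rewrite /edge_or_vertex /cayley_adj; case: eqVneq => //= _.
by rewrite mulKg invgM mulgVK.
Qed.

Lemma cayley_adjC S x y : cayley_adj S x y = cayley_adj S y x.
Proof. by rewrite /cayley_adj eq_sym orbC. Qed.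

(** A ball of the word metric as a list, with repetitions: balls have to be finite
both for one-endedness to say something about their
complements and for the supremum in [upper_distortion] to be a maximum. *)
Fixpoint word_ball S (n : nat) : seq G :=
  if n is n'.+1 then
    word_ball S n' ++
    [seq (s * g)%g | s <- S ++ [seq t^-1%g | t <- S], g <- word_ball S n']
  else [:: 1%g].

Lemma mem_word_ball S g m n :
  represents S g m -> (m <= n)%N -> g \in word_ball S n.
Proof.
move=> [w [wS <- <-]]; elim: n w wS => [|n IH] [|s w] //= wS mn.
- by rewrite big_nil mem_seq1.
- by rewrite mem_cat (IH [::]).
- case/andP: wS => sS wS; rewrite mem_cat big_cons; apply/orP; right.
  apply: allpairs_f; last exact: IH.
  rewrite mem_cat; case/orP: sS => [->//|sS]; apply/orP; right.
  by apply/mapP; exists s^-1%g; rewrite ?invgK.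
Qed.

End WordLength.

Section InfiniteCyclic.
Context {G : groupType}.
Context (h : G).

(** Modulo a positive exponent that kills [h], only finitely many powers are
left. *)
Lemma cyclic_subgroup_finite n :
  (0 < n)%N -> (h ^+ n)%g = 1%g -> finite_set (cyclic_subgroup h).
Proof.
move=> n0 hn.
have expm k : (h ^+ k = h ^+ (k %% n))%g.
  rewrite {1}(divn_eq k n) expgnDr mulnC expgnA hn.
  by rewrite expg1n mul1g.
apply: (@sub_finite_set _ _ [set` [seq (h ^+ i)%g | i <- iota 0 n] ++
                                  [seq (h ^- i)%g | i <- iota 0 n]]).
  move=> _ [k [] -> /=]; rewrite expm mem_cat; apply/orP; [left|right];
    by apply/mapP; exists (k %% n)%N; rewrite // mem_iota ltn_mod.
exact: finite_seq.
Qed.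

Context (infH : infinite_set (cyclic_subgroup h)).

Lemma expg_inj : injective (fun k => (h ^+ k)%g).
Proof.
move=> i j /=; wlog ij : i j / (i <= j)%N.
  move=> IH e; case: (leqP i j) => [ij|/ltnW ji]; first exact: IH.
  exact/esym/IH.
rewrite -{1}(subnK ij) expgnDr => e; apply/eqP; rewrite eqn_leq ij /= leqNgt.
apply/negP => ltij; apply: infH; apply: (@cyclic_subgroup_finite (j - i)%N).
  by rewrite subn_gt0.
by apply: (@mulIg _ (h ^+ i)%g); rewrite mul1g.
Qed.

(** After moving its inverse letters to the right, a word in [h] reads
[h ^+ a] times the inverse of [h ^+ b] with [a + b] letters; as [h] has
infinite order, its value [h ^+ k] forces [k = a - b]. *)
Lemma word_length_expg k : (k <= word_length [:: h] (h ^+ k)%g)%N.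
Proof.
have [w [wS <-]] := word_length_represents (represents_expg k (mem_head h [::])).
have [a [b [ab e]]] : exists a b, (a + b = size w)%N /\
    ((\prod_(s <- w) s) * h ^+ b = h ^+ a)%g.
  elim: w wS => [|s w IH] /=; first by exists 0%N, 0%N; rewrite big_nil mulg1.
  move=> /andP[+ /IH[a [b [ab e]]]]; rewrite big_cons !mem_seq1.
  case/orP => /eqP sh.
    exists a.+1, b; rewrite -ab addSn; split => //.
    by rewrite -mulgA e sh expgS.
  exists a, b.+1; rewrite -ab addnS; split => //.
  rewrite expgSr mulgA -[(s * _ * _)%g]mulgA e -[s]invgK sh.
  by rewrite -mulgA -expgSr expgS mulKg.
move=> wE; rewrite -ab; rewrite wE -expgnDr in e; move/expg_inj: e => <-.
by rewrite -addnA leq_addr.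
Qed.

End InfiniteCyclic.

(** Applied to rays and finite sets of vertices: a ray passes through a
given vertex at most once. *)
Lemma injective_leaves_seq (T : eqType) (f : nat -> T) (K : seq T) :
  injective f -> exists N, forall i, (N <= i)%N -> f i \notin K.
Proof.
move=> injf; elim: K => [|x K [N HN]]; first by exists 0%N.
have [[j fj]|nj] := pselect (exists j, f j = x).
  exists (maxn N j.+1) => i; rewrite geq_max => /andP[/HN Ni ji].
  rewrite inE negb_or Ni andbT -fj; apply/eqP => /injf ij.
  by move: ji; rewrite ij ltnn.
exists N => i /HN Ni; rewrite inE negb_or Ni andbT.
by apply/eqP => fi; apply: nj; exists i.
Qed.

(** * Curves and distances to sets in a metric space *)

Section Curves.
Context {R : realType} {X : metricType R}.
Implicit Types (c : R -> X) (x y z : X) (A B Y : set X) (a b r : R).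

(** Continuity on a closed interval in epsilon-delta form, which is easier to
restrict to subintervals and to reflect than the subspace topology. *)
Definition continuous_between a b c : Prop :=
  forall t, a <= t <= b -> forall e, 0 < e ->
  exists2 d, 0 < d & forall s, a <= s <= b -> `|s - t| < d ->
    mdist (c t) (c s) < e.

Lemma within_continuous_between a b c :
  {within `[a, b], continuous c} -> continuous_between a b c.
Proof.
move=> cc t tab e e0.
have tI : [set` `[a, b]] t by rewrite /= in_itv.
have /subspace_continuousP/(_ t tI) /cvg_ballP/(_ e e0) := cc.
rewrite near_withinE near_simpl => -[d /= d0 H]; exists d => // s sab st.
have := H s; rewrite ballEmdist /=; apply; last by rewrite in_itv.
by rewrite /ball_ /= distrC.
Qed.

Definition lipschitz_between a b c : Prop :=
  forall s t, a <= s <= b -> a <= t <= b -> mdist (c s) (c t) <= `|s - t|.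

Lemma lipschitz_within_continuous a b c :
  lipschitz_between a b c -> {within `[a, b], continuous c}.
Proof.
move=> lc; apply/subspace_continuousP => t; rewrite /= in_itv => tab.
apply/cvg_ballP => e e0; rewrite near_withinE near_simpl; exists e => //= s st sab.
rewrite ballEmdist /=; apply: le_lt_trans st; apply: lc => //.
Qed.

Lemma lipschitz_continuous_between a b c :
  lipschitz_between a b c -> continuous_between a b c.
Proof.
by move=> lc; apply/within_continuous_between/lipschitz_within_continuous.
Qed.

(** The sum in [curve_length] as a recursion on the subdivision; concatenation of
subdivisions is then a concatenation of lists. *)
Fixpoint broken_length c a (s : seq R) : R :=
  if s is x :: s' then mdist (c a) (c x) + broken_length c x s' else 0.

Lemma broken_lengthE c a b s :
  \sum_(i < size s) mdist (c (nth b (a :: s) i)) (c (nth b (a :: s) i.+1)) =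
  broken_length c a s.
Proof.
elim: s a => [|x s IH] a /=; first by rewrite big_ord0.
by rewrite big_ord_recl /= -IH.
Qed.

Lemma broken_length_ge0 c a s : 0 <= broken_length c a s.
Proof. by elim: s a => //= x s IH a; rewrite addr_ge0 ?mdist_ge0. Qed.

Lemma broken_length_cat c a s s' :
  broken_length c a (s ++ s') = broken_length c a s + broken_length c (last a s) s'.
Proof. by elim: s a => [|x s IH] a /=; rewrite ?add0r// IH addrA. Qed.

(** A subdivision of the small interval becomes one of the large interval by
adding the endpoints of the latter, if they are new; this only adds
nonnegative terms. *)
Lemma curve_length_sub c a b a' b' : a <= a' -> a' <= b' -> b' <= b ->
  (curve_length a' b' c <= curve_length a b c)%E.
Proof.
move=> aa ab bb; apply: ge_ereal_sup => _ [s [ps /eqP ls] <-].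
(* Subdivisions are strictly increasing, so an endpoint is added only if it is
   new. *)
pose s' := (if a < a' then [:: a'] else [::]) ++ s ++
           (if b' < b then [:: b] else [::]).
have ps' : itv_partition a b s'.
  rewrite /s' /itv_partition; move: aa bb; rewrite !le_eqVlt.
  case/predU1P => [->|aa]; rewrite ?ltxx ?aa /=;
    case/predU1P => [<-|bb]; rewrite ?ltxx ?bb /= ?cats0 ?ls ?eqxx //.
  - by rewrite cat_path ps last_cat /= ls bb.
  - by rewrite aa ps.
  - by rewrite aa cat_path ps last_cat /= ls bb.
apply: le_ereal_sup_tmp; exists (broken_length c a s')%:E.
  by exists s' => //; rewrite broken_lengthE.
rewrite broken_lengthE lee_fin /s' broken_length_cat broken_length_cat.
have -> : broken_length c (last a (if a < a' then [:: a'] else [::])) s =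
    broken_length c a' s.
  by move: aa; rewrite le_eqVlt => /predU1P[->|->] //=; rewrite ltxx.
rewrite -[leLHS]add0r lerD ?broken_length_ge0//.
by rewrite lerDl broken_length_ge0.
Qed.

Lemma lipschitz_curve_length a b c : lipschitz_between a b c ->
  (curve_length a b c <= (b - a)%:E)%E.
Proof.
move=> lc; apply: ge_ereal_sup => _ [s [ps /eqP ls] <-].
rewrite broken_lengthE lee_fin.
have lep (t : R) u : path <%R t u -> t <= last t u.
  by elim: u t => //= x u IH t /andP[/ltW tx /IH]; exact: le_trans.
suff H t u : path <%R t u -> a <= t -> last t u <= b ->
    broken_length c t u <= last t u - t.
  by rewrite -ls; apply: H => //; rewrite ls.
elim: u t => [|x u IH] t /=; first by rewrite subrr.
move=> /andP[tx xu] at' ub.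
have xb := le_trans (lep _ _ xu) ub; have ax := le_trans at' (ltW tx).
have := IH _ xu ax ub; have := lc t x.
rewrite at' (le_trans (ltW tx) xb) ax xb ltr0_norm ?subr_lt0// => /(_ isT isT).
lra.
Qed.

(** Connectedness by 1-Lipschitz curves parametrized from 0. Such curves are
rectifiable, and they can be reversed and concatenated without any reference
to subdivisions. *)
Definition reach Y x y : Prop := exists (b : R) c,
  [/\ 0 <= b, lipschitz_between 0 b c, c 0 = x, c b = y &
      forall t, 0 <= t <= b -> Y (c t)].

Lemma reach_refl Y x : Y x -> reach Y x x.
Proof.
move=> Yx; exists 0, (fun=> x); split => // s t _ _.
by rewrite mdistxx normr_ge0.
Qed.

Lemma reach_sym Y x y : reach Y x y -> reach Y y x.
Proof.
move=> [b [c [b0 lc c0 cb Yc]]]; exists b, (fun t => c (b - t)).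
split; rewrite ?subr0 ?subrr //.
  move=> s t s0 t0; apply: le_trans (lc _ _ _ _) _; try lra.
  by rewrite opprB addrC subrKA distrC.
by move=> t t0; apply: Yc; lra.
Qed.

Lemma reach_trans Y y x z : reach Y x y -> reach Y y z -> reach Y x z.
Proof.
move=> [b [c [b0 lc c0 cb Yc]]] [b' [c' [b0' lc' c0' cb' Yc']]].
exists (b + b'), (fun t => if t <= b then c t else c' (t - b)); split.
- lra.
- move=> s t s0 t0.
  (* Times on both sides of [b] are compared through the common point [c b]. *)
  wlog st : s t s0 t0 / s <= t.
    move=> H; have [|ts] := leP s t; first exact: H.
    by rewrite metric_sym distrC; apply: H => //; exact: ltW.
  have [sb|bs] := leP s b; have [tb|bt] := leP t b; last 2 first.
  + lra.
  + apply: le_trans (lc' _ _ _ _) _; try lra.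
    by rewrite opprB addrA subrK.
  + by apply: lc; lra.
  + apply: le_trans (metric_triangle _ (c b) _) _.
    rewrite {2}cb -c0'; apply: le_trans (lerD (lc _ _ _ _) (lc' _ _ _ _)) _;
      try lra.
    by rewrite !ler0_norm; lra.
- by rewrite b0.
- have [|_] := leP (b + b') b; last by rewrite addrC addKr.
  rewrite -{2}[b]addr0 lerD2l => b'0; have /eqP e : b' == 0 by lra.
  by rewrite e addr0 cb -c0' -e cb'.
- by move=> t t0; have [tb|bt] := leP t b; [apply: Yc|apply: Yc']; lra.
Qed.

Lemma reach_length_dist Y x y : reach Y x y -> (length_dist Y x y < +oo)%E.
Proof.
move=> [b [c [b0 lc c0 cb Yc]]].
apply: le_lt_trans (ltry (b - 0)); apply: le_trans (lipschitz_curve_length lc).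
apply: ereal_inf_lbound; exists 0, b, c; split => //.
exact: lipschitz_within_continuous.
Qed.

Lemma set_dist_has_inf x A : A !=set0 -> has_inf [set mdist x a | a in A].
Proof.
move=> [y Ay]; split; first by exists (mdist x y), y.
by exists 0 => _ [z _ <-]; exact: mdist_ge0.
Qed.

Lemma set_dist_le x y A : A y -> set_dist x A <= mdist x y.
Proof.
move=> Ay; apply: ge_inf; last by exists y.
by have [] := @set_dist_has_inf x A (ex_intro _ y Ay).
Qed.

Lemma set_dist_ge x A r : A !=set0 -> (forall y, A y -> r <= mdist x y) ->
  r <= set_dist x A.
Proof.
move=> [y Ay] H; apply: lb_le_inf; first by exists (mdist x y), y.
by move=> _ [z Az <-]; exact: H.
Qed.

Lemma set_dist_adherent x A r : A !=set0 -> set_dist x A < r ->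
  exists2 y, A y & mdist x y < r.
Proof.
move=> A0 xr; apply/not_exists2P => H; move: xr; rewrite ltNge => /negP; apply.
by apply: set_dist_ge => // y Ay; rewrite leNgt; apply/negP; case: (H y).
Qed.

Lemma set_dist_triangle x y A : A !=set0 ->
  set_dist x A <= mdist x y + set_dist y A.
Proof.
move=> A0; rewrite -lerBlDl; apply: set_dist_ge => // z Az.
rewrite lerBlDl; exact: le_trans (set_dist_le _ Az) (metric_triangle _ _ _).
Qed.

Lemma set_distU_ge x A B r : A !=set0 -> r <= set_dist x A -> r <= set_dist x B ->
  r <= set_dist x (A `|` B).
Proof.
move=> [y Ay] rA rB; apply: set_dist_ge; first by exists y; left.
by move=> z [/(set_dist_le x)/(le_trans rA)|/(set_dist_le x)/(le_trans rB)].
Qed.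

Lemma set_dist_subset x A B : A !=set0 -> A `<=` B ->
  set_dist x B <= set_dist x A.
Proof. by move=> A0 AB; apply: set_dist_ge => // y /AB/set_dist_le. Qed.

Lemma set_dist1 x y : set_dist x [set y] = mdist x y.
Proof. by rewrite /set_dist image_set1 inf1. Qed.

(** A curve that starts within [r] of [A] and ends at least [r] away from [A]: the
supremum of the times at which the distance is at most [r] is the last time
at which it equals [r]. *)
Lemma last_exit a b c A r : a <= b -> continuous_between a b c ->
  A !=set0 -> set_dist (c a) A <= r -> r <= set_dist (c b) A ->
  exists t, [/\ a <= t <= b, set_dist (c t) A = r &
                forall s, t <= s <= b -> r <= set_dist (c s) A].
Proof.
move=> ab cc A0 far rfb; pose f t := set_dist (c t) A.
have cf t e : a <= t <= b -> 0 < e -> exists2 d, 0 < d &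
    forall s, a <= s <= b -> `|s - t| < d -> `|f s - f t| < e.
  move=> tab e0; have [d d0 H] := cc t tab e e0; exists d => // s sab st.
  have := H s sab st; have := set_dist_triangle (c t) (c s) A0.
  have := set_dist_triangle (c s) (c t) A0; rewrite [mdist (c s) _]metric_sym.
  by rewrite -!/(f _) ltr_norml; lra.
pose E := [set s | a <= s <= b /\ f s <= r].
have Ea : E a by rewrite /E /=; split => //; rewrite lexx.
have supE : has_sup E by split; [exists a|exists b => s [/andP[]]].
have ubE s : E s -> s <= sup E by move=> Es; exact: sup_upper_bound.
have tab : a <= sup E <= b.
  by rewrite ubE//=; apply: ge_sup; [exists a|move=> s [/andP[]]].
have fgt s : sup E < s <= b -> r < f s.
  move=> /andP[ts sb]; rewrite ltNge; apply/negP => fs.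
  suff /ubE : E s by rewrite leNgt ts.
  by split => //; rewrite sb andbT; lra.
have fle : f (sup E) <= r.
  rewrite leNgt; apply/negP => rf.
  have [|d d0 H] := cf (sup E) (f (sup E) - r) tab; first by rewrite subr_gt0.
  have [s Es st] := sup_adherent d0 supE.
  have := H s Es.1; have := ubE s Es; rewrite ltr_norml => sE.
  rewrite ltr_norml => /(_ ltac:(lra)).
  by case: Es => _; lra.
have fE : f (sup E) = r.
  apply/eqP; rewrite eq_le fle /= leNgt; apply/negP => rf.
  have [|d d0 H] := cf (sup E) (r - f (sup E)) tab; first by rewrite subr_gt0.
  have tb : sup E < b.
    rewrite lt_neqAle; case/andP: tab => _ ->; rewrite andbT; apply/eqP => e.
    by move: rf; rewrite e ltNge => /negP; apply.
  pose s := Num.min b (sup E + d / 2).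
  have sb : s <= b by rewrite /s ge_min lexx.
  have ts : sup E < s by rewrite /s lt_min tb; lra.
  have sd : s <= sup E + d / 2 by rewrite /s ge_min lexx orbT.
  have := H s; rewrite !ltr_norml => /(_ ltac:(lra) ltac:(lra)).
  by have := fgt s; rewrite ts sb => /(_ isT); lra.
exists (sup E); split => // s /andP[]; rewrite le_eqVlt => /predU1P[<-|ts] sb.
  by rewrite -/(f _) fE.
by apply/ltW/fgt; rewrite ts.
Qed.

(** The time reversal of [last_exit]. *)
Lemma first_entry a b c A r : a <= b -> continuous_between a b c ->
  A !=set0 -> r <= set_dist (c a) A -> set_dist (c b) A <= r ->
  exists t, [/\ a <= t <= b, set_dist (c t) A = r &
                forall s, a <= s <= t -> r <= set_dist (c s) A].
Proof.
move=> ab cc A0 ra rb.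
have cc' : continuous_between (- b) (- a) (c \o -%R).
  move=> t tab e e0; have [|d d0 H] := cc (- t) _ e e0; first lra.
  exists d => // s sab st; apply: H; first lra.
  by rewrite -opprD normrN.
have := @last_exit (- b) (- a) (c \o -%R) A r.
rewrite lerN2 /= !opprK => /(_ ab cc' A0 rb ra) [t [tab ft H]].
exists (- t); split => //; first lra.
by move=> s sat; have := H (- s); rewrite /= opprK; apply; lra.
Qed.

End Curves.

(** * Metric geometry of the Cayley graph *)

Section CayleyGeometry.
Context {R : realType} {G : groupType} {S : generating_seq G}.
Local Notation X := (cayley_graph R S).
Implicit Types (p q : X) (x y z t : G).

Lemma bary_coord_vertex x z : bary_coord (@vertex R G S x) z = (z == x)%:R.
Proof. by rewrite /= /bary subr0 mul1r mul0r addr0. Qed.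

(** The coordinate at [x] determines the point on the edge; the clauses are split
because the edge may be degenerate, with [x = y]. *)
Lemma on_edgeP x y (f : G -> R) : on_edge x y f ->
  [/\ 0 <= f x <= 1, x != y -> f y = 1 - f x, x = y -> f x = 1 &
      forall z, z != x -> z != y -> f z = 0].
Proof.
move=> [t [t0 t1 ->]]; rewrite /bary; split.
- by rewrite eqxx mulr1; case: eqP => _; rewrite ?mulr1 ?mulr0; lra.
- by move=> xy; rewrite !eqxx (eq_sym y) (negPf xy) !mulr1 !mulr0; lra.
- by move=> ->; rewrite !eqxx !mulr1 subrK.
- by move=> z /negPf-> /negPf->; rewrite !mulr0 addr0.
Qed.

(** A segment inside an edge is a piecewise linear path. *)
Lemma mdist_edge x y p q : edge_or_vertex S x y ->
  on_edge x y (bary_coord p) -> on_edge x y (bary_coord q) ->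
  mdist p q <= `|bary_coord p x - bary_coord q x|.
Proof.
move=> xy px qx; apply: cayley_dist_le.
by rewrite -[`|_|]addr0; exact: pl_cons xy px qx (pl_nil _).
Qed.

Lemma mdist_edge_vertex x y p : edge_or_vertex S x y ->
  on_edge x y (bary_coord p) -> mdist p (vertex R S x) <= 1.
Proof.
move=> xy px; apply: le_trans (mdist_edge xy px (on_edgel _ _ _ _)) _.
have [/andP[p0 p1] _ _ _] := on_edgeP px.
by rewrite bary_coord_vertex eqxx mulr1n ler0_norm; lra.
Qed.

Lemma mdist_le_represents x y n : represents S (x^-1 * y)%g n ->
  mdist (vertex R S x) (vertex R S y) <= n%:R.
Proof.
move=> [w [wS <- wE]]; elim: w x wS wE => [|s w IH] x /=.
  rewrite big_nil => _ e; have -> : y = x by rewrite -[y](mulVKg x) -e mulg1.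
  by rewrite mdistxx.
move=> /andP[sS ww]; rewrite big_cons => e.
have ad := edge_or_vertex_mulr x sS.
apply: le_trans (metric_triangle _ (vertex R S (x * s)%g) _) _.
rewrite -[_.+1]add1n natrD lerD//.
  rewrite metric_sym; apply: mdist_edge_vertex ad _; exact: on_edger.
by apply: IH => //; rewrite invgM -mulgA -e mulKg.
Qed.

(** The word metric is a lower bound for the length of paths, by induction on the
path. For the induction the starting point may lie inside an edge; the
endpoints of that edge are then the vertices [z] with positive coordinate, and
[1 - bary_coord p z] is the distance from [p] to [z]. *)
Lemma pl_path_word_length p q l : pl_path p q l -> forall t, q = vertex R S t ->
  forall z, 0 < bary_coord p z ->
  (word_length S (z^-1 * t)%g)%:R <= l + (1 - bary_coord p z).
Proof.
elim=> [{}p|x y {}p p' q' {}l xy px p'x _ IH] t e z.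
  rewrite e bary_coord_vertex; case: eqP => [->|]; last by rewrite ltxx.
  rewrite mulVg subrr addr0 => _.
  by rewrite lern0 -leqn0 word_length_le//; exact: represents1.
move=> pz; have [] := on_edgeP px; have [] := on_edgeP p'x.
move=> p'x01 p'y p'xy p'0 px01 py pxy p0.
have {}IH u := IH t e u.
have [xyE|nxy] := eqVneq x y.
  have zx : z = x.
    apply/eqP/negPn/negP => zx; move: pz; rewrite p0 ?ltxx//.
    by rewrite -xyE.
  have := IH x; rewrite zx (pxy xyE) (p'xy xyE) subrr normr0 add0r !addr0.
  by rewrite ltr01 => /(_ isT).
have wl1 u v : cayley_adj S u v ->
    (word_length S (u^-1 * t)%g)%:R <= (word_length S (v^-1 * t)%g)%:R + 1 :> R.
  move=> /cayley_adj_represents uv; rewrite natr1 ler_nat -add1n.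
  have [n vt] := gensP S (v^-1 * t)%g.
  apply: word_length_le; have := representsM uv (word_length_represents vt).
  by rewrite mulgA mulgK.
have adj : cayley_adj S x y by move: xy; rewrite /edge_or_vertex (negPf nxy).
have {wl1} [wlx wly] : (word_length S (x^-1 * t)%g)%:R <=
    (word_length S (y^-1 * t)%g)%:R + 1 :> R /\
    (word_length S (y^-1 * t)%g)%:R <= (word_length S (x^-1 * t)%g)%:R + 1 :> R.
  by split; apply: wl1 => //; rewrite cayley_adjC.
have {}p'y := p'y nxy; have {}py := py nxy.
have n1 := ler_norm (bary_coord p x - bary_coord p' x).
have n2 : bary_coord p' x - bary_coord p x <= `|bary_coord p x - bary_coord p' x|.
  by rewrite distrC ler_norm.
(* If [p'] has a zero coordinate at [z], it is the other end of the edge. *)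
have [zE|zx] := eqVneq z x.
  rewrite zE; have [p'x0|p'x0] := ltrP 0 (bary_coord p' x).
    by have := IH x p'x0; lra.
  have := IH y; rewrite p'y => /(_ ltac:(lra)); lra.
have [zE|zy] := eqVneq z y; last by move: pz; rewrite p0 ?ltxx.
rewrite zE; have [p'y0|p'y0] := ltrP 0 (bary_coord p' y).
  by have := IH y p'y0; lra.
by have := IH x; rewrite p'y in p'y0 *; move=> /(_ ltac:(lra)); lra.
Qed.

Lemma word_length_le_mdist x y :
  (word_length S (x^-1 * y)%g)%:R <= mdist (vertex R S x) (vertex R S y).
Proof.
apply: cayley_dist_ge => l /pl_path_word_length/(_ y erefl x).
by rewrite bary_coord_vertex eqxx subrr addr0; apply.
Qed.

(** The edge itself, parametrized by arc length. Clamping the parameter to the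
unit interval makes the parametrization a function on the whole line. *)
Lemma reach_edge (Y : set X) x y : edge_or_vertex S x y ->
  (forall p, on_edge x y (bary_coord p) -> Y p) ->
  reach Y (vertex R S x) (vertex R S y).
Proof.
move=> xy HY.
have [<-|nxy] := eqVneq x y; first by apply/reach_refl/HY; exact: on_edgel.
pose clamp (s : R) := Num.max 0 (Num.min 1 s).
have clampP s : 0 <= s <= 1 -> clamp s = s.
  by move=> /andP[s0 s1]; rewrite /clamp min_r// max_r.
have clamp01 s : 0 <= clamp s <= 1.
  by rewrite /clamp le_max lexx /= ge_max ler01 ge_min lexx.
have cE s : on_edge x y (bary x y (clamp s)).
  by exists (clamp s); case/andP: (clamp01 s).
pose c s : X := CayleyPoint (ex_intro _ x (ex_intro _ y (conj xy (cE s)))).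
have cx s : bary_coord (c s) x = 1 - clamp s.
  by rewrite /= /bary eqxx (negPf nxy) mulr1 mulr0 addr0.
exists 1, c; split => //.
- move=> s t s0 t0; apply: le_trans (@mdist_edge x y (c s) (c t) xy (cE s) (cE t)) _.
  by rewrite !cx !clampP// opprB addrC subrKA distrC.
- by apply: coord_inj; apply/funext => z; rewrite /= clampP ?lexx ?ler01// /bary !mul0r.
- apply: coord_inj; apply/funext => z; rewrite bary_coord_vertex /= clampP ?lexx ?ler01//.
  by rewrite /bary subrr mul0r mul1r add0r.
- by move=> t _; apply: HY; exact: cE.
Qed.

Lemma reach_path (Y : set X) (P : pred G) x s :
  (forall u v p, edge_or_vertex S u v -> on_edge u v (bary_coord p) ->
     P u -> P v -> Y p) ->
  path (cayley_adj S) x s -> all P (x :: s) ->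
  reach Y (vertex R S x) (vertex R S (last x s)).
Proof.
move=> HY; elim: s x => [|y s IH] x /=.
  move=> _ /andP[Px _]; apply: reach_refl.
  exact: (HY x x _ (edge_or_vertex_refl S x) (on_edgel _ _ _ _)).
move=> /andP[xy ys] /and3P[Px Py Ps].
apply: reach_trans (IH y ys _); last by rewrite /= Py.
have xy' : edge_or_vertex S x y by rewrite /edge_or_vertex xy orbT.
by apply: reach_edge => // p px; exact: HY xy' px Px Py.
Qed.

End CayleyGeometry.

(** * Crossing from one set to another *)

Section Crossing.
Context {R : realType} {X : metricType R}.
Implicit Types (c : R -> X) (x y z : X) (A B Y : set X) (a b r : R).

(** The part of a Lipschitz curve after its last exit from a neighbourhood of
[A]. *)
Lemma reach_last_exit Y A x z r : A !=set0 -> reach Y x z ->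
  set_dist x A <= r -> r <= set_dist z A ->
  exists y, [/\ Y y, set_dist y A = r & reach [set p | r <= set_dist p A] y z].
Proof.
move=> A0 [b [c [b0 lc <- <- Yc]]] ra rb.
have [t [tb ct H]] := last_exit b0 (lipschitz_continuous_between lc) A0 ra rb.
exists (c t); split => //; first exact: Yc.
exists (b - t), (fun s => c (t + s)); split; rewrite ?addr0 //.
- lra.
- move=> s u s0 u0; apply: le_trans (lc _ _ _ _) _; try lra.
  by rewrite opprD addrACA subrr add0r.
- by rewrite addrC subrK.
- by move=> s s0 /=; apply: H; lra.
Qed.

(** A curve from the [r]-neighbourhood of [A] to that of [B] has a subcurve that
stays out of both and joins their boundaries: cut after the last exit from the
first, then before the first entry into the second. The separation hypothesis
says that on the curve the two neighbourhoods are far apart; in particular no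
point of the curve lies in both, so an endpoint on the boundary of one is not
inside the other. *)
Lemma curve_crossing c a b A B r D : a <= b -> continuous_between a b c ->
  A !=set0 -> B !=set0 -> 0 < D ->
  (forall s t, a <= s <= b -> a <= t <= b -> set_dist (c s) A <= r ->
     set_dist (c t) B <= r -> D <= mdist (c s) (c t)) ->
  set_dist (c a) A <= r -> set_dist (c b) B <= r ->
  exists s t, [/\ a <= s, s <= t, t <= b, D <= mdist (c s) (c t) &
    [/\ set_dist (c s) (A `|` B) = r, set_dist (c t) (A `|` B) = r &
        forall u, s <= u <= t -> r <= set_dist (c u) (A `|` B)]].
Proof.
move=> ab cc A0 B0 D0 sep aA bB.
have far s : a <= s <= b -> set_dist (c s) A <= r -> set_dist (c s) B <= r ->
    False.
  by move=> sab sA sB; have := sep s s sab sab sA sB; rewrite mdistxx; lra.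
have bA : r <= set_dist (c b) A.
  by rewrite leNgt; apply/negP => /ltW/far; apply => //; rewrite ab lexx.
have [s [/andP[as_ sb] sA Hs]] := last_exit ab cc A0 aA bA.
have sB : r <= set_dist (c s) B.
  rewrite leNgt; apply/negP => /ltW; apply: far; rewrite ?as_ ?sA //.
have cc' : continuous_between s b c.
  move=> t tsb e e0; have [|d d0 H] := cc t _ e e0; first lra.
  by exists d => // u usb; apply: H; lra.
have [t [/andP[st tb] tB Ht]] := first_entry sb cc' B0 sB bB.
have Hu u : s <= u <= t -> r <= set_dist (c u) (A `|` B).
  by move=> sut; apply: set_distU_ge => //; [apply: Hs|apply: Ht]; lra.
exists s, t; split => //.
  by apply: sep; rewrite ?sA ?tB //; lra.
split => //; apply/eqP; rewrite eq_le Hu ?lexx ?st // andbT.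
  by rewrite -sA; apply: set_dist_subset => // ?; left.
by rewrite -tB; apply: set_dist_subset => // ?; right.
Qed.

End Crossing.

(** * Rays and one-endedness *)

Section Rays.
Context {G : groupType} {S : generating_seq G}.

Lemma joined_outside_sym (K : seq G) x y :
  joined_outside S K x y -> joined_outside S K y x.
Proof.
move=> [p [pp <- pK]]; exists (rev (belast x p)); split.
- rewrite rev_path; apply: sub_path pp => u v.
  by rewrite cayley_adjC.
- by case: p {pp pK} => //= z p; rewrite rev_cons last_rcons.
- rewrite -rev_rcons -lastI; apply/allP => z; rewrite mem_rev.
  exact: (allP pK).
Qed.

(** A tail of a ray avoids a given finite set and joins any two of its own
vertices. *)
Lemma ray_equiv_refl (f : nat -> G) : is_ray S f -> ray_equiv S f f.
Proof.
move=> [injf adjf] K; have [N HN] := injective_leaves_seq K injf.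
suff H i k : (N <= i)%N -> joined_outside S K (f i) (f (i + k)%N).
  exists N => i j Ni Nj; case: (leqP i j) => [ij|/ltnW ji].
    by rewrite -(subnKC ij); exact: H.
  by apply: joined_outside_sym; rewrite -(subnKC ji); exact: H.
elim: k i => [|k IH] i Ni.
  by exists [::]; rewrite addn0; split => //=; rewrite HN.
rewrite addnS -addSn; have [p [pp lp pK]] := IH i.+1 (leqW Ni).
by exists (f i.+1 :: p); split => //=; rewrite ?adjf // HN.
Qed.

(** Both rays define the only end, and the class of [f] contains [g] because the
class of [g] does. *)
Lemma one_ended_joined (f g : nat -> G) (K : seq G) : one_ended S ->
  is_ray S f -> is_ray S g ->
  exists N, forall i j, (N <= i)%N -> (N <= j)%N ->
    joined_outside S K (f i) (g j).
Proof.
move=> [E endsE] rf rg.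
have classE (k : nat -> G) : is_ray S k ->
    [set k' | is_ray S k' /\ ray_equiv S k k'] = E.
  move=> rk; suff : ends S [set k' | is_ray S k' /\ ray_equiv S k k'].
    by rewrite endsE.
  by exists k.
have : [set k' | is_ray S k' /\ ray_equiv S g k'] g.
  by split => //; exact: ray_equiv_refl.
by rewrite classE // -(classE f rf) => -[_ /(_ K)].
Qed.

Lemma is_ray_expg (g : G) : (g \in (S : seq G)) || (g^-1 \in (S : seq G))%g ->
  injective (fun k => g ^+ k)%g -> is_ray S (fun k => g ^+ k)%g.
Proof.
move=> gS injg; split => // k.
have := edge_or_vertex_mulr (g ^+ k)%g gS; rewrite -expgSr.
by case/orP => // /eqP/injg/n_Sn.
Qed.

End Rays.

(** The half-line of nonnegative powers of [g]; the infinite cyclic subgroup is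
cut into the half-lines of [h] and of its inverse. *)
Definition powers {G : groupType} (g : G) : set G := range (fun k => g ^+ k)%g.

Lemma cyclic_subgroup_powers {G : groupType} (h : G) :
  cyclic_subgroup h = powers h `|` powers h^-1%g.
Proof.
apply/seteqP; split => [_ [k [] ->]|_ [[k _ <-]|[k _ <-]]].
- by left; exists k.
- by right; exists k; rewrite // expVgn.
- by exists k; left.
- by exists k; right; rewrite expVgn.
Qed.

(** * Lower bounds for the distortion *)

Section Distortion.
Context {R : realType} {G : groupType} {S : generating_seq G}.
Context (h : G) (infH : infinite_set (cyclic_subgroup h)).

Lemma le_upper_distortion k (r : R) : (word_length S (h ^+ k)%g)%:R <= r ->
  k%:R <= upper_distortion S (cyclic_subgroup h) h r.
Proof.
move=> kr; apply: (@le_trans _ _ (word_length [:: h] (h ^+ k)%g)%:R).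
  by rewrite ler_nat word_length_expg.
apply: ub_le_sup; last by exists (h ^+ k)%g => //; split => //; exists k; left.
exists (\max_(g <- word_ball S (Num.truncn r)) word_length [:: h] g)%:R.
move=> _ [g [_ gr] <-]; rewrite ler_nat.
have [m gm] := gensP S g; apply: leq_bigmax_seq => //.
apply: mem_word_ball (word_length_represents gm) _.
by rewrite -ltnS -(ltr_nat R); apply: le_lt_trans gr (truncnS_gt r).
Qed.

Lemma upper_distortion_ge (r s : R) : h \in (S : seq G) -> 0 <= s ->
  s + 1 <= r -> s <= upper_distortion S (cyclic_subgroup h) h r.
Proof.
move=> hS s0 sr; apply: (@le_trans _ _ (Num.truncn s).+1%:R).
  exact/ltW/truncnS_gt.
apply: le_upper_distortion; apply: (@le_trans _ _ (Num.truncn s).+1%:R).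
  by rewrite ler_nat; apply/word_length_le/represents_expg.
by apply: le_trans sr; rewrite -natr1 lerD2r truncn_le.
Qed.

End Distortion.

(** * Comparison of the divergences *)

Section Divergence.
Context {R : realType} {G : groupType} {S : generating_seq G}.
Local Notation X := (cayley_graph R S).
Local Notation V := (vertex R S).
Local Notation line g := (V @` powers g).
Implicit Types (g h : G) (p q : X) (r x : R).

Lemma line_neq0 g : line g !=set0.
Proof. by exists (V 1%g), 1%g => //; exists 0%N. Qed.

Lemma nbhd_complE (A : set G) r :
  nbhd_compl A r = [set p : X | r <= set_dist p (V @` A)].
Proof.
apply/seteqP; split => p; rewrite /nbhd_compl /nbhd /subgroup_dist /=.
  by move=> /negP; rewrite -leNgt.
by move=> rp; apply/negP; rewrite -leNgt.
Qed.

Lemma reach_powers g i : (g \in (S : seq G)) || (g^-1 \in (S : seq G))%g ->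
  reach [set p | set_dist p (line g) <= 1] (V 1%g) (V (g ^+ i)%g).
Proof.
move=> gS; elim: i => [|i IH].
  apply: reach_refl => /=; apply: (@le_trans _ _ 0); last exact: ler01.
  by rewrite -(mdistxx (V 1%g)); apply: set_dist_le; exists 1%g => //; exists 0%N.
apply: reach_trans IH _.
have edge := edge_or_vertex_mulr (g ^+ i)%g gS; rewrite -expgSr in edge.
apply: (reach_edge edge) => p pE /=; apply: le_trans (mdist_edge_vertex edge pE).
by apply: set_dist_le; exists (g ^+ i)%g => //; exists i.
Qed.

(** The half-line of [g] runs from the identity to beyond the sphere of radius
[r]; after its last exit from the [r]-ball it stays outside. *)
Lemma sphere_point g i r : (g \in (S : seq G)) || (g^-1 \in (S : seq G))%g ->
  0 <= r -> r <= mdist (V (g ^+ i)%g) (V 1%g) ->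
  exists y : X, [/\ set_dist y [set V 1%g] = r, set_dist y (line g) <= 1 &
    reach [set p | r <= set_dist p [set V 1%g]] y (V (g ^+ i)%g)].
Proof.
move=> gS r0 ri; have e0 : [set V 1%g] !=set0 by exists (V 1%g).
have [||y [Yy yr yi]] := reach_last_exit e0 (reach_powers i gS) (r := r).
- by rewrite set_dist1 mdistxx.
- by rewrite set_dist1.
- by exists y.
Qed.

(** An edge whose ends are both at distance at least [r + 1] from the identity
stays at distance at least [r]. Hence a large enough finite ball [K] turns
combinatorial paths outside [K] into curves outside the [r]-ball. *)
Lemma joined_outside_reach r : exists K : seq G, forall x y : G,
  joined_outside S K x y ->
  [/\ r <= mdist (V x) (V 1%g), r <= mdist (V y) (V 1%g) &
      reach [set p | r <= set_dist p [set V 1%g]] (V x) (V y)].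
Proof.
pose N := (Num.truncn r).+1.
have rN : r <= N%:R by exact/ltW/truncnS_gt.
exists (word_ball S N) => x y [s [xs <- sK]].
have far z : z \notin word_ball S N -> r + 1 <= mdist (V z) (V 1%g).
  move=> zK; rewrite metric_sym.
  apply: le_trans (word_length_le_mdist _ _); rewrite invg1 mul1g.
  apply: (@le_trans _ _ N.+1%:R); first by rewrite -natr1 lerD2r.
  rewrite ler_nat ltnNge; apply/negP => zN; case/negP: zK.
  by have [m zm] := gensP S z; apply: mem_word_ball (word_length_represents zm) zN.
have far' z : z \notin word_ball S N -> r <= mdist (V z) (V 1%g).
  by move=> /far; lra.
split.
- by apply: far'; apply: (allP sK); rewrite mem_head.
- by apply: far'; apply: (allP sK); rewrite mem_last.
apply: reach_path xs sK => u v p uv pE uK _ /=; rewrite set_dist1.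
have := far u uK; have := mdist_edge_vertex uv pE.
have := metric_triangle (V u) p (V 1%g); rewrite [mdist (V u) p]metric_sym.
lra.
Qed.

(** The two half-lines of an infinite cyclic subgroup leave the [r]-ball for the
last time at points of the sphere; these are joined outside the ball, first
along the half-lines and then, far away, by one-endedness. *)
Lemma sphere_pair h r : one_ended S -> h \in (S : seq G) ->
  infinite_set (cyclic_subgroup h) -> 0 <= r ->
  exists y z : X,
  [/\ set_dist y [set V 1%g] = r, set_dist z [set V 1%g] = r,
      set_dist y (line h) <= 1, set_dist z (line h^-1%g) <= 1 &
      reach [set p | r <= set_dist p [set V 1%g]] y z].
Proof.
move=> G1 hS infH r0.
have hS1 : (h \in (S : seq G)) || (h^-1 \in (S : seq G))%g by rewrite hS.
have hS2 : (h^-1 \in (S : seq G))%g || (h^-1^-1 \in (S : seq G))%g.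
  by rewrite invgK hS orbT.
have inj1 := expg_inj infH.
have inj2 : injective (fun k => h^-1 ^+ k)%g.
  by move=> i j /=; rewrite !expVgn => /invg_inj/inj1.
have [K HK] := joined_outside_reach r.
have [N HN] := one_ended_joined K G1 (is_ray_expg hS1 inj1) (is_ray_expg hS2 inj2).
have [rN rN' HNN] := HK _ _ (HN N N (leqnn _) (leqnn _)).
have [y [yr yh Hy]] := sphere_point hS1 r0 rN.
have [z [zr zh Hz]] := sphere_point hS2 r0 rN'.
by exists y, z; split => //; apply: reach_trans Hy (reach_trans HNN (reach_sym Hz)).
Qed.

(** Here the distortion enters. Suppose that [p] is near [h ^+ k], that [q] is near
[h ^- j] and that [p] and [q] are closer than [n * x]. Then [h ^+ (j + k)] has
word length below [(n + 4) * x], so [k <= j + k] is at most the distortion at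
that radius. Then so is the distance from [h ^+ k] to the identity, and [p] is
too close to the identity. *)
Lemma lines_separated h (n : nat) x p q :
  h \in (S : seq G) -> infinite_set (cyclic_subgroup h) -> 1 < x ->
  3 * upper_distortion S (cyclic_subgroup h) h ((n%:R + 4) * x)
    <= mdist p (V 1%g) ->
  set_dist p (line h) <= x -> set_dist q (line h^-1%g) <= x ->
  n%:R * x <= mdist p q.
Proof.
set D := upper_distortion _ _ _ _ => hS infH x1 pD ph qh.
have n0 : 0 <= n%:R :> R by [].
have nx0 : 0 <= n%:R * x by rewrite mulr_ge0//; lra.
(* A point within [x] of a half-line is at distance less than [2 * x] from one of
   its vertices; this error of [2 * x] is at most [D]. *)
have D2x : 2 * x <= D by apply: upper_distortion_ge => //; lra.
rewrite leNgt; apply/negP => pq.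
have [|_ [_ [k _ <-] <-] pk] := set_dist_adherent (line_neq0 h) (x := p) (r := 2 * x).
  by lra.
have [|_ [_ [j _ <-] <-] qj] :=
    set_dist_adherent (line_neq0 h^-1%g) (x := q) (r := 2 * x); first lra.
have jkD : (j + k)%:R <= D.
  apply: le_upper_distortion => //; have := word_length_le_mdist (R := R) (S := S) (h^-1 ^+ j)%g (h ^+ k)%g.
  rewrite expVgn invgK -expgnDr => H; apply: le_trans H _.
  rewrite -expVgn.
  have := metric_triangle (V (h^-1 ^+ j)%g) q (V (h ^+ k)%g).
  have := metric_triangle q p (V (h ^+ k)%g).
  rewrite [mdist _ q]metric_sym [mdist q p]metric_sym; lra.
have kD : mdist (V (h ^+ k)%g) (V 1%g) <= D.
  apply: le_trans jkD; rewrite metric_sym.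
  apply: le_trans (mdist_le_represents (n := k) _) _.
    by rewrite invg1 mul1g; apply: represents_expg.
  by rewrite ler_nat leq_addl.
have := metric_triangle p (V (h ^+ k)%g) (V 1%g); lra.
Qed.

(** By [lines_separated] such a curve has a crossing subcurve, whose endpoints
compete in the infimum that defines the lower divergence. *)
Lemma lower_divergence_le_curve h (n : nat) (rho x a b : R) (c : R -> X) :
  h \in (S : seq G) -> infinite_set (cyclic_subgroup h) ->
  rho <= 1 -> (0 < n)%N -> 1 < x ->
  a <= b -> {within `[a, b], continuous c} ->
  (forall t, a <= t <= b ->
     3 * upper_distortion S (cyclic_subgroup h) h ((n%:R + 4) * x)
       <= mdist (c t) (V 1%g)) ->
  set_dist (c a) (line h) <= x -> set_dist (c b) (line h^-1%g) <= x ->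
  (lower_divergence S (cyclic_subgroup h) n rho x <= curve_length a b c)%E.
Proof.
move=> hS infH rho1 n0 x1 ab cc cD ca cb.
have [->|fin] := eqVneq (curve_length a b c) +oo%E; first by rewrite leey.
have [||||s [t [as_ st tb nst [sx tx stx]]]] := curve_crossing ab
  (within_continuous_between cc) (line_neq0 h) (line_neq0 h^-1%g)
  (r := x) (D := n%:R * x) => //.
- by rewrite mulr_gt0 ?ltr0n//; lra.
- by move=> s t sab tab; apply: lines_separated (cD s sab).
have HE : V @` cyclic_subgroup h = line h `|` line h^-1%g.
  by rewrite cyclic_subgroup_powers image_setU.
have length_le r : r <= x ->
    (outer_dist (S := S) (cyclic_subgroup h) r (c s) (c t) <= curve_length a b c)%E.
  move=> rx; apply: le_trans (curve_length_sub c as_ st tb).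
  apply: ereal_inf_lbound; exists s, t, c; split => //.
    apply: continuous_subspaceW cc => u /=; rewrite !in_itv /=; lra.
  move=> u; rewrite in_itv /= nbhd_complE HE /= => /stx; lra.
apply: le_trans (length_le (rho * x) _); last first.
  by rewrite ger_pMl//; lra.
apply: ereal_inf_lbound; exists (c s), (c t); split => //.
- by rewrite /nbhd_boundary /subgroup_dist HE.
- by rewrite /nbhd_boundary /subgroup_dist HE.
- by apply: le_lt_trans (length_le x (lexx _)) _; rewrite ltey.
Qed.

End Divergence.

Theorem theorem6p7 (R : realType) (G : groupType) (S : generating_seq G)
    (h : G) (H : set G)
    (G1 : one_ended S)
    (HE : H = cyclic_subgroup h)
    (Hinf : infinite_set H)
    (hS : h \in (S : seq G))
    (sigma : nat -> R -> R -> \bar R)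
    (delta : R -> R -> \bar R)
    (sigmaE : sigma = lower_divergence S H)
    (deltaE : delta = upper_divergence S [set 1%g])
    (rho : R) (rho0 : 0 < rho) (rho1 : rho <= 1)
    (n : nat) (n2 : (2 <= n)%N) :
  dominated (sigma n rho)
    (delta rho \o (fun r => 3 / rho * upper_distortion S H h r)).
Proof.
subst H sigma delta.
(* The radius [(n + 4) * x] is the one at which [lines_separated] measures the
   distortion. *)
exists (n%:R + 4), 1, 1; split => //.
move=> x x1 /=; set D := upper_distortion _ _ _ _.
have n0 : 0 <= n%:R :> R by [].
have nx0 : 0 <= n%:R * x by rewrite mulr_ge0//; lra.
have D2x : 2 * x <= D by apply: upper_distortion_ge => //; lra.
have [|y [z [yr zr yh zh yz]]] := sphere_pair G1 hS Hinf (r := 3 / rho * D).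
  by rewrite mulr_ge0 ?divr_ge0 //; lra.
have rhoE : rho * (3 / rho * D) = 3 * D.
  by rewrite mulrA mulrCA divff ?mulr1// gt_eqF.
(* It suffices to bound the lower divergence by the length of every curve that
   competes in the distance between [y] and [z]. *)
apply: (@le_trans _ _ (outer_dist [set 1%g] (rho * (3 / rho * D)) y z)).
  apply: le_ereal_inf_tmp => _ [a [b [c [ab cc [ca cb] cY ->]]]].
  apply: lower_divergence_le_curve => //; rewrite ?ca ?cb; try lra.
  - exact: ltnW.
  - move=> t tab; have := cY t; rewrite in_itv => /(_ tab).
    by rewrite nbhd_complE image_set1 /= set_dist1 rhoE.
apply: (@le_trans _ _ (upper_divergence S [set 1%g] rho (3 / rho * D))); last first.
  by rewrite leeDl// lee_fin mul1r; lra.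
apply: ereal_sup_ubound; exists y, z; split => //.
- by rewrite /nbhd_boundary /subgroup_dist image_set1.
- by rewrite /nbhd_boundary /subgroup_dist image_set1.
- by apply: reach_length_dist; rewrite nbhd_complE image_set1.
Qed.
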